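(* Let $G=\mathbb{Z}^d$, let $\Sigma$ be a finite alphabet and let $x\in\Sigma^G$ be a Toeplitz array with period structure $(\Gamma_n)_{n\in\mathbb{N}}$ satisfying $\bigcap_{n\in\mathbb{N}}\Gamma_n=\{0\}$. Let $(D_n)_{n\in\mathbb{N}}$ be a sequence of subsets of $G$ such that for all $n\in\mathbb{N}$: (i) $G=\bigcup_{m\in\mathbb{N}}D_m$; (ii) $0\in D_n\subseteq D_{n+1}$; (iii) $D_n$ is a fundamental domain of $G/\Gamma_n$; (iv) $D_l=\bigcup_{\gamma\in D_l\cap\Gamma_n}(\gamma+D_n)$ for all $l>n$; (v) $(D_m)_{m\in\mathbb{N}}$ is a Følner sequence in $G$. If the Toeplitz subshift $(\overline{O_G}(x),G)$ is strictly ergodic, then for every $t\in\mathbb{N}$ and $B\in W_{D_t}(x)$ there exists a real number $\nu(B)$ such that $\mathrm{ap}(B,C)$ converges to $\nu(B)$ uniformly in $C\in W_{D_s}(x)$ as $s\to\infty$.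
   Context: $\mathbb{N}=\{1,2,\dots\}$. $\Sigma^G$ carries the product topology and the shift action $(gx)(h)=x(h+g)$; $\overline{O_G}(x)$ is the orbit closure. $x\in\Sigma^G$ is a Toeplitz array if for every $g\in G$ there is a finite index subgroup $\Gamma$ with $x(g+\gamma)=x(g)$ for all $\gamma\in\Gamma$. For a finite index subgroup $\Gamma$ and $\alpha\in\Sigma$ let $\mathrm{Per}(x,\Gamma,\alpha)=\{g\in G: x(g+\gamma)=\alpha\ \forall\gamma\in\Gamma\}$ and $\mathrm{Per}(x,\Gamma)=\bigcup_{\alpha\in\Sigma}\mathrm{Per}(x,\Gamma,\alpha)$. $\Gamma$ is an essential period of $x$ if $\mathrm{Per}(x,\Gamma)\ne\emptyset$ and for all $h\in G$: if $\mathrm{Per}(x,\Gamma,\alpha)\subseteq\mathrm{Per}(x,\Gamma,\alpha)-h$ for all $\alpha\in\Sigma$, then $h\in\Gamma$. A period structure of $x$ is a decreasing sequence $(\Gamma_n)_{n\in\mathbb{N}}$ of finite index subgroups, each an essential period of $x$, with $G=\bigcup_n\mathrm{Per}(x,\Gamma_n)$. A system is strictly ergodic if it is minimal (all orbits dense) and has exactly one invariant Borel probability measure. A fundamental domain of $G/\Gamma$ contains exactly one representative of each coset. A Følner sequence is a sequence of finite sets $F_n$ with $\#[(g+F_n)\triangle F_n]/\#F_n\to0$ for all $g\in G$. $W_{D_t}(x)$ is the set of blocks $B:D_t\to\Sigma$ for which there exists $\gamma\in\Gamma_t$ with $B(d)=x(d+\gamma)$ for all $d\in D_t$. For $s\ge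 t$, $B\in W_{D_t}(x)$, $C\in W_{D_s}(x)$, $$\mathrm{ap}(B,C)=\frac{1}{\#(D_s\cap\Gamma_t)}\cdot\#\{\gamma\in D_s\cap\Gamma_t : \forall d\in D_t:\ C(d+\gamma)=B(d)\}.$$ Uniform convergence means: for every $\varepsilon>0$ there is $s_0$ such that $|\mathrm{ap}(B,C)-\nu(B)|<\varepsilon$ for all $s\ge s_0$ and $C\in W_{D_s}(x)$. *)

(* Defs.v *)
From HB Require Import structures.
From mathcomp Require Import all_boot all_order all_algebra finmap.
From mathcomp Require Import all_classical all_reals all_analysis.

Set Implicit Arguments.
Unset Strict Implicit.
Unset Printing Implicit Defensive.

Import Order.TTheory GRing.Theory Num.Theory.
Import numFieldNormedType.Exports.

Local Open Scope classical_set_scope.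
Local Open Scope ring_scope.

(* [fset_set A] is empty when [A] is infinite, so [cardR] is only meaningful on
   finite sets. *)
Definition cardR (R : realType) (T : choiceType) (A : set T) : R :=
  #|` fset_set A|%fset%:R.
Arguments cardR R {T} A.

Section group.
Variable G : zmodType.
Implicit Types (Gamma D : set G) (g h : G).

Definition translate g D : set G := [set g + k | k in D].

Definition subgroup Gamma : Prop :=
  Gamma 0 /\ forall g h, Gamma g -> Gamma h -> Gamma (g - h).

Definition finite_index Gamma : Prop :=
  subgroup Gamma /\ finite_set [set translate g Gamma | g in [set: G]].

Definition fundamental_domain Gamma D : Prop :=
  forall g, exists! r, D r /\ translate g Gamma r.

Definition folner (R : realType) (D : nat -> set G) : Prop :=
  (forall n, finite_set (D n)) /\
  forall g, (fun n => cardR R (translate g (D n) `+` D n) / cardR R (D n))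
              @ \oo --> (0 : R).

End group.

Section system.
Variables (R : realType) (G : Type) (X : ptopologicalType) (act : G -> X -> X).

Definition borel_probability := probability (g_sigma_algebraType (@open X)) R.

Definition minimal : Prop :=
  forall y : X, dense [set act g y | g in [set: G]].

Definition invariant_measure (mu : borel_probability) : Prop :=
  forall g (A : set (g_sigma_algebraType (@open X))), measurable A ->
    mu (act g @^-1` A) = mu A.

(* A library measure is a function on all sets of which only the values on
   measurable sets are constrained; uniqueness is therefore stated on
   measurable sets. *)
Definition strictly_ergodic : Prop :=
  minimal /\
  exists mu : borel_probability, invariant_measure mu /\
    forall nu : borel_probability, invariant_measure nu ->
      forall A : set (g_sigma_algebraType (@open X)), measurable A ->
        nu A = mu A.

End system.
Arguments strictly_ergodic R {G X} act.

Notation config G S := {ptws G%type -> discrete_topology S%type}.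

Section configurations.
Variables (G : zmodType) (S : finType).
Implicit Types (x y : config G S) (Gamma : set G).

Definition shift (g : G) x : config G S := fun h => x (h + g).

Definition shift_orbit x : set (config G S) := [set shift g x | g in [set: G]].

Definition orbit_closure x : set (config G S) := closure (shift_orbit x).

Lemma shift_continuous g : continuous (shift g).
Proof.
move=> x; have Fx : Filter (shift g @ nbhs x) by exact: fmap_filter.
suff : {ptws, shift g @ nbhs x --> shift g x} by [].
rewrite cvg_sup => i U [_ [[V oV <-] Vx] VU].
have Vn : nbhs (x (i + g)) V by apply: open_nbhs_nbhs; split.
have Bx := @proj_continuous G (fun=> discrete_topology S) (i + g) x V Vn.
exact: (@filterS _ (nbhs x) _ _ _ (fun y => VU (shift g y)) Bx).
Qed.

Lemma shift0 x : shift 0 x = x.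
Proof. by apply/funext => h; rewrite /shift addr0. Qed.

Lemma shiftD g h x : shift g (shift h x) = shift (g + h) x.
Proof. by apply/funext => k; rewrite /shift addrA. Qed.

Lemma orbit_closure_refl x : orbit_closure x x.
Proof. by apply: subset_closure; exists 0; rewrite ?shift0. Qed.

Lemma orbit_closure_shift x g y :
  orbit_closure x y -> orbit_closure x (shift g y).
Proof.
move=> xy B /(@shift_continuous g y) /xy [_ [[h _ <-]] /=].
by rewrite shiftD => Bx; exists (shift (g + h) x); split=> //; exists (g + h).
Qed.

Definition subshift x := set_type (orbit_closure x).

HB.instance Definition _ x := Topological.on (subshift x).
HB.instance Definition _ x :=
  isPointed.Build (subshift x) (SigSub (mem_set (@orbit_closure_refl x))).

Definition subshift_act x (g : G) (y : subshift x) : subshift x :=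
  SigSub (mem_set (@orbit_closure_shift x g _ (set_valP y))).

Definition toeplitz x : Prop :=
  forall g, exists2 Gamma, finite_index Gamma &
    forall gamma, Gamma gamma -> x (g + gamma) = x g.

Definition Per_at x Gamma (alpha : S) : set G :=
  [set g | forall gamma, Gamma gamma -> x (g + gamma) = alpha].

Definition Per x Gamma : set G :=
  \bigcup_(alpha in [set: S]) Per_at x Gamma alpha.

Definition essential_period x Gamma : Prop :=
  Per x Gamma !=set0 /\
  forall h, (forall alpha, Per_at x Gamma alpha `<=`
                           [set k - h | k in Per_at x Gamma alpha]) ->
            Gamma h.

Definition period_structure x (Gamma : nat -> set G) : Prop :=
  [/\ forall n, Gamma n.+1 `<=` Gamma n,
      forall n, finite_index (Gamma n),
      forall n, essential_period x (Gamma n)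
    & [set: G] = \bigcup_n Per x (Gamma n)].

Definition blocks x Gamma (D : set G) : set (D -> S) :=
  [set B | exists2 gamma, Gamma gamma &
             forall d : D, B d = x (set_val d + gamma)].

(* [e] is the point [d + gamma], which must lie in [E] for [C] to be defined
   there. *)
Definition ap (R : realType) Gamma (D E : set G) (B : D -> S) (C : E -> S) : R :=
  (cardR R (E `&` Gamma))^-1 *
  cardR R [set gamma | (E `&` Gamma) gamma /\
             forall d : D, exists2 e : E, set_val e = set_val d + gamma
                                        & C e = B d].

End configurations.
Arguments ap {G S} R Gamma {D E} B C.

(* Main.v *)
Require Import Defs.
From HB Require Import structures.
From mathcomp Require Import all_boot all_order all_algebra finmap.
From mathcomp Require Import all_classical all_reals all_analysis.

Set Implicit Arguments.
Unset Strict Implicit.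
Unset Printing Implicit Defensive.

Import Order.TTheory GRing.Theory Num.Theory.
Import numFieldNormedType.Exports.

Local Open Scope classical_set_scope.
Local Open Scope ring_scope.

(** Fix [t] and a block [B] on [D t].  The analytic input is the classical
    consequence of unique ergodicity: if [mu] is the invariant probability, for a
    clopen set [A] of the subshift, the frequency with which the translates of a
    point [y] by the elements of [D s] fall into [A] tends to [mu A], uniformly
    in [y] ([uniform_frequency]).  The difficulty is that [ap] counts occurrences of
    [B] at the positions of [Gamma t] only, whereas such a frequency counts all
    positions.  The essential period hypothesis removes it: there is a finite
    window [W] such that the shift of [x] by [g] agrees with [x] on [W] exactly
    when [g] lies in [Gamma t] ([phase_window]).  Hence the cylinder [A] of the
    points that show [B] on [D t] and agree with [x] on [W] sees precisely the
    occurrences of [B] at positions of [Gamma t].  As [D s] is tiled by the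
    translates of [D t] along [D s `&` Gamma t], passing from one normalisation
    to the other costs the constant factor [#|D t|], so that [ap] is [#|D t|]
    times a frequency of visits to [A] ([ap_frequency]), and
    [nu = #|D t| * mu A].

    Uniform convergence of frequencies is proved by contradiction.  If it fails,
    infinitely many [s] carry a point whose frequency is at distance at least
    [eps] from [mu A]; an ultrafilter concentrated on these [s] turns the
    frequencies into a finitely additive probability on all subsets of the
    subshift, whose value at [A] is still at distance at least [eps] from
    [mu A].  The subshift being compact, this set function is countably additive
    on clopen sets for free, and it extends to a Borel probability
    ([clopen_extension]), which is invariant because the [D s] are
    asymptotically invariant ([frequency_limit]).  This contradicts the
    uniqueness of [mu]. *)

(** * From finitely additive set functions on clopen sets to Borel measures *)

(** A copy of [X], so that the algebra of clopen sets can be its structure of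
    measurable sets without competing with the Borel one. *)
Definition clopen_algebra (X : ptopologicalType) : Type := X.

Definition clopen_display : measure_display.
Proof. exact: default_measure_display. Qed.

Section clopen_sets.
Variable X : ptopologicalType.

Lemma clopen0 : clopen (set0 : set X).
Proof. by split; [exact: open0 | exact: closed0]. Qed.

Lemma clopenU : setU_closed (@clopen X).
Proof. by move=> A B [? ?] [? ?]; split; [exact: openU | exact: closedU]. Qed.

Lemma clopenC : setC_closed (@clopen X).
Proof.
by move=> A [oA cA]; split; [exact: closed_openC | exact: open_closedC].
Qed.

HB.instance Definition _ := Pointed.on (clopen_algebra X).
HB.instance Definition _ := isAlgebraOfSets.Build clopen_display
  (clopen_algebra X) clopen0 clopenU clopenC.

End clopen_sets.

(** Second countability and zero-dimensionality combined, in a form which makes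
    it immediate that the clopen sets generate the Borel ones. *)
Definition clopen_sigma_base (X : topologicalType) : Prop :=
  forall U : set X, open U ->
    exists2 F : (set X)^nat, (forall n, clopen (F n)) & U = \bigcup_n F n.

Lemma sigma_clopen_borel (X : ptopologicalType) :
  clopen_sigma_base X -> <<s @clopen X >> = <<s @open X >>.
Proof.
move=> baseX; apply/seteqP; split.
  by apply: sub_smallest2r; [exact: smallest_sigma_algebra | move=> A []].
apply: smallest_sub; first exact: smallest_sigma_algebra.
move=> U /baseX[F cF ->].
apply: (@sigma_algebra_bigcup _ setT) => n.
exact: sub_sigma_algebra.
Qed.

Lemma borel_measure_eq (R : realType) (X : ptopologicalType)
    (m1 m2 : {measure set (g_sigma_algebraType (@open X)) -> \bar R}) :
  clopen_sigma_base X -> (m1 setT < +oo)%E ->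
  (forall A : set X, clopen A -> m1 A = m2 A) ->
  forall A : set (g_sigma_algebraType (@open X)), measurable A -> m1 A = m2 A.
Proof.
move=> baseX m1oo m12 A mA.
apply: (@measure_unique _ R (g_sigma_algebraType (@open X)) (@clopen X)
  (fun=> setT)) => //.
- by rewrite sigma_clopen_borel.
- exact: clopenI.
- by move=> _; exact: clopenT.
- by rewrite bigcup_const.
Qed.

Definition finitely_additive_probability (R : realType) (T : Type)
    (l : set T -> R) : Prop :=
  [/\ forall A, 0 <= l A, l setT = 1 &
      forall A B, A `&` B = set0 -> l (A `|` B) = l A + l B].

Section clopen_extension.
Variables (R : realType) (X : ptopologicalType) (l : set X -> R).
Hypotheses (compactX : compact [set: X]) (baseX : clopen_sigma_base X).
Hypothesis l_prob : finitely_additive_probability l.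

Definition clopen_premeasure : set (clopen_algebra X) -> \bar R :=
  fun A => (l A)%:E.

Lemma clopen_premeasure_ge0 A : (0 <= clopen_premeasure A)%E.
Proof. by case: l_prob => l0 _ _; rewrite lee_fin. Qed.

Lemma clopen_premeasure_semi_additive :
  measure_function.semi_additive clopen_premeasure.
Proof.
case: l_prob => _ _ lU.
have l00 : l set0 = 0.
  have := lU set0 set0 (setI0 _); rewrite setU0 => /eqP.
  by rewrite -subr_eq0 opprD addNKr oppr_eq0 => /eqP.
move=> F n mF tF _; elim: n => [|n ih].
  by rewrite !big_ord0 /clopen_premeasure l00.
rewrite big_ord_recr [RHS]big_ord_recr /= -ih /clopen_premeasure -EFinD lU //.
rewrite -bigcup_mkord; apply/seteqP; split=> // y [[i /= lin Fi] Fn].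
move/trivIsetP: tF => /(_ i n I I).
by rewrite neq_ltn lin => /(_ isT) /seteqP[/(_ y) Fin _]; exact: Fin.
Qed.

HB.instance Definition _ := isContent.Build _ (clopen_algebra X) R
  clopen_premeasure clopen_premeasure_ge0 clopen_premeasure_semi_additive.

(** Compactness does all the work: a countable cover of a clopen, hence compact,
    set by open sets has a finite subcover, so that finite subadditivity is
    enough. *)
Lemma clopen_premeasure_sigma_subadditive :
  measurable_subset_sigma_subadditive clopen_premeasure.
Proof.
move=> A F cF cA AF.
have : compact (A : set X) by apply: (subclosed_compact cA.2 compactX).
rewrite compact_cover => /(_ nat setT F (fun n _ => (cF n).1) AF)[I _ AI].
have AI' : A `<=` \bigcup_(i in [set` I]) F i by [].
rewrite nneseries_esumT; last by move=> n; exact: clopen_premeasure_ge0.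
apply: esum_ge; exists [set` I]; first by split.
exact: content_sub_fsum.
Qed.

HB.instance Definition _ := Content_SigmaSubAdditive_isMeasure.Build _ R
  (clopen_algebra X) clopen_premeasure clopen_premeasure_sigma_subadditive.

(** The outer measure induced by the premeasure, viewed on the Borel sets. *)
Definition borel_extension : set (g_sigma_algebraType (@open X)) -> \bar R :=
  measure_extension clopen_premeasure.

Lemma borel_extensionE (A : set X) : clopen A -> borel_extension A = (l A)%:E.
Proof.
by move=> cA; rewrite /borel_extension /measure_extension measurable_mu_extE.
Qed.

Lemma borel_extension0 : borel_extension set0 = 0.
Proof. exact: measure0. Qed.

Lemma borel_extension_ge0 A : (0 <= borel_extension A)%E.
Proof. exact: mu_ext_ge0. Qed.

Lemma borel_extension_sigma_additive : semi_sigma_additive borel_extension.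
Proof.
move=> F mF tF mUF.
apply: (@measure_semi_sigma_additive _ _ _
  (measure_extension clopen_premeasure)); rewrite /measurable /=.
- by move=> n; rewrite [X in X _]sigma_clopen_borel //; exact: mF.
- exact: tF.
- by rewrite [X in X _]sigma_clopen_borel.
Qed.

HB.instance Definition _ := isMeasure.Build _ _ _ borel_extension
  borel_extension0 borel_extension_ge0 borel_extension_sigma_additive.

Lemma borel_extensionT : borel_extension setT = 1%E.
Proof. by rewrite borel_extensionE; [case: l_prob => _ -> | exact: clopenT]. Qed.

HB.instance Definition _ :=
  Measure_isProbability.Build _ _ _ borel_extension borel_extensionT.

Lemma clopen_extension : exists m : borel_probability R X,
  forall A : set X, clopen A -> m A = (l A)%:E.
Proof. by exists borel_extension; exact: borel_extensionE. Qed.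

End clopen_extension.

(** * Topology of the subshift *)

Section subshift_topology.
Variables (G : countZmodType) (S : finType).
Implicit Types (x y z : config G S).

(** The topology of the type of the points of [K] is induced by the inclusion
    into [X], so a cluster point in [X] of the image filter, which lies in [K],
    is a cluster point of the filter itself. *)
Lemma compact_set_type (X : topologicalType) (K : set X) :
  compact K -> compact [set: set_type K].
Proof.
move=> cK F PF _.
have PvF : ProperFilter (set_val @ F) by exact: fmap_proper_filter.
have vFK : (set_val @ F) K.
  by apply: (@filterE _ F) => y; exact: set_valP.
have [p [Kp clp]] := cK _ PvF vFK.
exists (SigSub (mem_set Kp)); split=> // A B FA [_ [[V oV <-] Vp] VB].
have vFA : (set_val @ F) (set_val @` A).
  by apply: (@filterS _ F _ A) => //; exact: preimage_image.
have [_ [[y Ay <-] Vy]] := clp _ _ vFA (open_nbhs_nbhs (conj oV Vp)).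
by exists y; split=> //; exact: VB.
Qed.

Lemma compact_config : compact [set: config G S].
Proof.
have cS : compact [set: discrete_topology S].
  by apply: finite_compact; exact: (@finite_finset S setT).
have := @tychonoff G (fun=> discrete_topology S) (fun=> setT) (fun=> cS).
by congr compact; apply/seteqP; split.
Qed.

Lemma compact_subshift x : compact [set: subshift x].
Proof.
apply: compact_set_type.
by apply: (subclosed_compact _ compact_config) => //; exact: closed_closure.
Qed.

(** The sets of configurations that agree with [y] on a finite set form a
    neighbourhood basis of [y]: the filter which they generate converges to [y]
    because each of its coordinates does. *)
Lemma nbhs_config y (V : set (config G S)) : nbhs y V ->
  exists F : seq G, [set z : config G S | {in F, forall g, z g = y g}] `<=` V.
Proof.
pose cyl (F : seq G) : set (config G S) := [set z | {in F, forall g, z g = y g}].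
pose cyls : set_system (config G S) := [set A | exists F, cyl F `<=` A].
have Fcyls : Filter cyls.
  split=> [|A B [F FA] [H HB]|A B AB [F FA]].
  - by exists nil.
  - exists (F ++ H) => z zy; split.
      by apply: FA => g Fg; apply: zy; rewrite mem_cat Fg.
    by apply: HB => g Hg; apply: zy; rewrite mem_cat Hg orbT.
  - by exists F; exact: subset_trans AB.
suff : {ptws, cyls --> y} by move=> cvgy /cvgy.
rewrite cvg_sup => i U [_ [[W oW <-] Wy] WU].
by exists [:: i] => z zy; apply: WU => /=; rewrite /proj zy ?mem_head.
Qed.

Lemma clopen_coordinate x g (P : set S) :
  clopen [set y : subshift x | P (set_val y g)].
Proof.
pose coord (y : subshift x) : discrete_topology S := set_val y g.
have cg : continuous coord.
  move=> y; apply: (@continuous_comp (subshift x) (config G S)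
    (discrete_topology S) set_val (fun z => z g));
    first exact: initial_continuous.
  exact: (@proj_continuous G (fun=> discrete_topology S) g).
split.
  by apply: (open_comp (f := coord)) => // *; exact: discrete_open.
by apply: (closed_comp (f := coord)) => // *; exact: discrete_closed.
Qed.

Definition cylinder x (p : seq (G * S)) : set (subshift x) :=
  [set y | forall c, c \in p -> set_val y c.1 = c.2].

Lemma clopen_cylinder x p : clopen (@cylinder x p).
Proof.
elim: p => [|c p IH].
  rewrite (_ : cylinder _ = setT); first exact: clopenT.
  by apply/seteqP; split.
rewrite (_ : cylinder _ = [set y | [set c.2] (set_val y c.1)] `&` cylinder p).
  by apply: clopenI => //; exact: clopen_coordinate.
apply/seteqP; split=> y.
  move=> yc; split; first by apply: yc; rewrite mem_head.
  by move=> e ep; apply: yc; rewrite inE ep orbT.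
by move=> [yc yp] e; rewrite inE => /predU1P[-> //|]; exact: yp.
Qed.

(** Cylinders are described by finite lists of pairs from countable types, so
    there are countably many of them; an open set is the union of those which it
    contains. *)
Lemma clopen_sigma_base_subshift x : clopen_sigma_base (subshift x).
Proof.
move=> U oU.
exists (fun n : nat =>
    if choice.unpickle n : option (seq (G * S)) is Some p then
          [set y | cylinder p y /\ @cylinder x p `<=` U] else set0).
  move=> n; case: choice.unpickle => [p|]; last exact: clopen0.
  have [pU|npU] := pselect (@cylinder x p `<=` U).
    rewrite (_ : mkset _ = cylinder p); first exact: clopen_cylinder.
    by apply/seteqP; split=> y // [].
  rewrite (_ : mkset _ = set0); first exact: clopen0.
  by apply/seteqP; split=> y // [].
apply/seteqP; split=> [y Uy|y [n _]]; last first.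
  by case: choice.unpickle => // p [yp pU]; exact: pU.
have [_ [[V oV <-] Vy] VU] : nbhs y U by apply: open_nbhs_nbhs.
have [F FV] := nbhs_config (open_nbhs_nbhs (conj oV Vy)).
exists (choice.pickle [seq (g, set_val y g : S) | g <- F]) => //.
rewrite choice.pickleK; split.
  by move=> _ /mapP[g _ ->].
move=> z zp; apply: VU; apply: FV => g Fg.
by apply: (zp (g, _)); apply/mapP; exists g.
Qed.

Lemma subshift_act_continuous x g : continuous (@subshift_act G S x g).
Proof.
move=> y U [_ [[V oV <-] Vy] VU].
have sc : continuous (fun z : subshift x => Defs.shift g (set_val z)).
  move=> z; apply: (@continuous_comp (subshift x) (config G S) (config G S)
    set_val (Defs.shift g)); first exact: initial_continuous.
  exact: Defs.shift_continuous.
have := sc y V (open_nbhs_nbhs (conj oV Vy)).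
by apply: (@filterS _ (nbhs y)) => z Vz; exact: VU.
Qed.

Lemma subshift_actD x g h (y : subshift x) :
  subshift_act g (subshift_act h y) = subshift_act (g + h) y.
Proof. by apply/val_inj; rewrite /= Defs.shiftD. Qed.

End subshift_topology.

(** * Cardinalities of finite sets *)

Section cardinal.
Variables (R : realType) (T : choiceType).
Implicit Types A B : set T.

Lemma cardR_ge0 A : 0 <= cardR R A.
Proof. exact: ler0n. Qed.

Lemma cardR_gt0 A : finite_set A -> A !=set0 -> 0 < cardR R A.
Proof.
move=> fA [a Aa]; rewrite ltr0n cardfs_gt0; apply/fset0Pn; exists a.
by rewrite in_fset_set // inE.
Qed.

Lemma le_cardR A B : finite_set B -> A `<=` B -> cardR R A <= cardR R B.
Proof.
move=> fB AB; rewrite ler_nat; apply: fsubset_leq_card.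
by rewrite -fset_set_sub //; exact: sub_finite_set fB.
Qed.

Lemma cardRU A B : finite_set A -> finite_set B -> A `&` B = set0 ->
  cardR R (A `|` B) = cardR R A + cardR R B.
Proof.
move=> fA fB AB; rewrite /cardR fset_setU // cardfsU -fset_setI // AB fset_set0.
by rewrite cardfs0 subn0 natrD.
Qed.

Lemma cardR_image (T' : choiceType) (f : T -> T') A : finite_set A ->
  {in A &, injective f} -> cardR R (f @` A) = cardR R A.
Proof.
move=> fA injf; rewrite /cardR fset_set_image // card_in_imfset //=.
by move=> a b; rewrite !in_fset_set //; exact: injf.
Qed.

Lemma ler_dist_cardR A B : finite_set A -> finite_set B ->
  `|cardR R A - cardR R B| <= cardR R (A `+` B).
Proof.
move=> fA fB.
have split_card (C E : set T) : finite_set C ->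
    cardR R C = cardR R (C `&` E) + cardR R (C `\` E).
  move=> fC; rewrite -cardRU ?setUIDK //; first exact: finite_setIl.
    exact: finite_setD.
  by apply/seteqP; split=> // c [[_ Ec] []].
rewrite (split_card A B fA) (split_card B A fB) (setIC B A) opprD addrACA.
rewrite subrr add0r.
rewrite /setY cardRU //; first last.
- by apply/seteqP; split=> // c [[Ac _] []].
- exact: finite_setD.
- exact: finite_setD.
rewrite (le_trans (ler_normB _ _)) // !ger0_norm //; exact: cardR_ge0.
Qed.

End cardinal.

Lemma cardRX (R : realType) (T1 T2 : choiceType) (A : set T1) (B : set T2) :
  finite_set A -> finite_set B ->
  cardR R (A `*` B) = cardR R A * cardR R B.
Proof.
move=> fA fB; rewrite /cardR -natrM -(size_allpairs (@pair T1 T2)); congr _%:R.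
apply: perm_size; apply: uniq_perm => [||[a b]].
- exact: fset_uniq.
- by apply: allpairs_uniq => [||[? ?] [? ?] _ _ []];
    first [exact: fset_uniq | move=> -> ->].
- apply/idP/allpairsP => /=.
    rewrite in_fset_set ?inE; last exact: finite_setX.
    by move=> [Aa Bb]; exists (a, b); rewrite !in_fset_set // !inE.
  rewrite in_fset_set; last exact: finite_setX.
  by move=> [[a' b'] /= []]; rewrite !in_fset_set // !inE => Aa Bb [-> ->].
Qed.

(** * Frequencies of visits and their limits *)

(** A cluster point of the image of an ultrafilter is a limit, since the preimage
    of a neighbourhood or its complement belongs to the ultrafilter. *)
Lemma cvg_ultra (T : Type) (U : set_system T) (X : topologicalType) (K : set X)
    (f : T -> X) : UltraFilter U -> compact K -> (forall t, K (f t)) ->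
  exists p : X, f @ U --> p.
Proof.
move=> UU cK Kf.
have PU : ProperFilter U by exact: ultra_proper.
have [p [_ clp]] : K `&` cluster (f @ U) !=set0.
  by apply: cK; apply: (@filterE _ U).
exists p => V Vp.
have [//|nV] := @in_ultra_setVsetC _ U (f @^-1` V) UU.
by have [z []] := clp (~` V) V nV Vp.
Qed.

Section frequency.
Variables (R : realType) (G : zmodType) (X : Type) (act : G -> X -> X).
Implicit Types (E : set G) (y : X) (A : set X).

Definition visits E y A : set G := E `&` [set g | A (act g y)].

Definition frequency E y A : R := cardR R (visits E y A) / cardR R E.

Lemma frequency_ge0 E y A : 0 <= frequency E y A.
Proof. by apply: divr_ge0; exact: cardR_ge0. Qed.

Lemma frequency_le1 E y A : finite_set E -> frequency E y A <= 1.
Proof.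
move=> fE; have [E0|/set0P/(cardR_gt0 R fE) E0] := eqVneq E set0.
  by rewrite /frequency {2}E0 /cardR fset_set0 cardfs0 invr0 mulr0 ler01.
by rewrite ler_pdivrMr // mul1r; apply: le_cardR => // g [].
Qed.

Lemma frequencyT E y : finite_set E -> E !=set0 -> frequency E y setT = 1.
Proof.
move=> fE E0; rewrite /frequency (_ : visits E y setT = E) ?divff //.
  by rewrite gt_eqF // cardR_gt0.
by apply/seteqP; split=> [g []|].
Qed.

Lemma frequencyU E y A B : finite_set E -> A `&` B = set0 ->
  frequency E y (A `|` B) = frequency E y A + frequency E y B.
Proof.
move=> fE AB; rewrite -mulrDl -cardRU; [congr (cardR R _ / _)| | |].
- by rewrite -setIUr.
- exact: finite_setIl.
- exact: finite_setIl.
- apply/seteqP; split=> // g [[_ Ag] [_ Bg]].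
  have : (A `&` B) (act g y) by split.
  by rewrite AB.
Qed.

(** Visiting the preimage of [A] under [g] during [E] amounts to visiting [A]
    during [g + E], and the two sets of times differ by at most their symmetric
    difference. *)
Lemma frequency_preimage E y A g :
  (forall h z, act g (act h z) = act (g + h) z) -> finite_set E ->
  `|frequency E y (act g @^-1` A) - frequency E y A| <=
    cardR R (translate g E `+` E) / cardR R E.
Proof.
move=> actD fE; rewrite -mulrBl normrM (ger0_norm (x := _^-1)); last first.
  by rewrite invr_ge0 cardR_ge0.
apply: ler_wpM2r; first by rewrite invr_ge0 cardR_ge0.
have ftE : finite_set (translate g E) by exact: finite_image.
have -> : cardR R (visits E y (act g @^-1` A)) =
    cardR R (visits (translate g E) y A).
  rewrite -(@cardR_image R _ _ (+%R g)); last 2 first.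
  - exact: finite_setIl.
  - by move=> h k _ _; exact: addrI.
  congr (cardR R _).
  apply/seteqP; split=> [_ [h [Eh /= Ah] <-]|_ [[h Eh <-] /= Ah]].
    by split; [exists h | rewrite /= -actD].
  by exists h => //; split=> //=; rewrite actD.
apply: (le_trans (ler_dist_cardR R (finite_setIl _ ftE) (finite_setIl _ fE))).
apply: le_cardR; first by rewrite finite_setU; split; exact: finite_setD.
by rewrite /visits => h [[[? ?] n]|[[? ?] n]];
  [left | right]; split=> // ?; apply: n.
Qed.

End frequency.
Arguments visits {G X} act E y A.
Arguments frequency R {G X} act E y A.

Section frequency_limit.
Variables (R : realType) (G : zmodType) (X : ptopologicalType).
Variable act : G -> X -> X.
Hypothesis actD : forall g h z, act g (act h z) = act (g + h) z.
Hypothesis act_cont : forall g, continuous (act g).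
Hypotheses (compactX : compact [set: X]) (baseX : clopen_sigma_base X).
Variable D : nat -> set G.
Hypotheses (D_neq0 : forall n, D n !=set0) (D_folner : folner R D).

Lemma clopen_act g A : clopen A -> clopen (act g @^-1` A).
Proof.
move=> [oA cA]; split; first by apply: open_comp => // z _; exact: act_cont.
by apply: closed_comp => // z _; exact: act_cont.
Qed.

(** For each [g], the image of [m] by [g] is a Borel measure that agrees with [m]
    on clopen sets, hence everywhere. *)
Lemma invariant_clopen (m : borel_probability R X) :
  (forall g A, clopen A -> m (act g @^-1` A) = m A) -> invariant_measure act m.
Proof.
move=> inv g A mA.
pose T := g_sigma_algebraType (@open X).
have mact : measurable_fun [set: T] (act g : T -> T).
  apply: (@measurability _ _ T T setT (act g) (@open X)) => //.
  move=> _ [U oU <-]; rewrite setTI; apply: sub_sigma_algebra.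
  by apply: open_comp => // z _; exact: act_cont.
pose push : {measure set T -> \bar R} := pushforward m (act g : T -> T).
apply: (@borel_measure_eq R X (push mact) m) => //; last exact: inv.
by rewrite /push /= /pushforward preimage_setT probability_setT ltry.
Qed.

(** Along an ultrafilter the bounded frequencies all converge at once, which
    yields a limit measure without any choice of subsequence. *)
Lemma frequency_limit (U : set_system nat) (y : nat -> X) :
  UltraFilter U -> \oo `<=` U ->
  exists2 m : borel_probability R X, invariant_measure act m &
    forall A, clopen A -> frequency R act (D n) (y n) A @[n --> U] --> fine (m A).
Proof.
move=> UU ooU; have [D_fin D_inv] := D_folner.
have PU : ProperFilter U by exact: ultra_proper.
have lim_freq (A : set X) : exists p : R,
    frequency R act (D n) (y n) A @[n --> U] --> p.
  apply: (cvg_ultra UU (@segment_compact _ 0 1)) => n /=.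
  by rewrite in_itv /= frequency_ge0 frequency_le1.
have [l lP] := choice lim_freq.
have l_unique A p : frequency R act (D n) (y n) A @[n --> U] --> p -> p = l A.
  by move=> cp; apply: (cvg_unique _ cp (lP A)).
have l_prob : finitely_additive_probability l.
  split.
  - move=> A; apply: (cvgr_to_ge (lP A)).
    by apply: nearW => n; exact: frequency_ge0.
  - apply/esym/l_unique.
    rewrite (_ : (fun n => _) = cst 1); first exact: cvg_cst.
    by apply/funext => n; rewrite frequencyT.
  - move=> A B AB; apply/esym/l_unique.
    rewrite (_ : (fun n => _) =
        (fun n => frequency R act (D n) (y n) A + frequency R act (D n) (y n) B)).
      by apply: cvgD; exact: lP.
    by apply/funext => n; rewrite frequencyU.
have [m mE] := clopen_extension compactX baseX l_prob.
exists m; last by move=> A cA; rewrite mE //; exact: lP.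
apply: invariant_clopen => g A cA.
rewrite !mE //; last exact: clopen_act.
congr EFin; apply/eqP; rewrite -subr_eq0 -normr_le0.
have dcvg := cvg_norm (cvgB (lP (act g @^-1` A)) (lP A)).
have fcvg : cardR R (translate g (D n) `+` D n) / cardR R (D n) @[n --> U]
    --> (0 : R).
  by apply: cvg_trans (D_inv g); exact: cvg_app ooU.
apply: (ler_cvg_to (dcvg _ _) fcvg); apply: nearW => n.
exact: frequency_preimage.
Qed.

(** Unique ergodicity forces uniform convergence: times [s] at which some point
    has a frequency far from [mu A] would, if infinitely many, produce in the
    limit an invariant probability other than [mu]. *)
Lemma uniform_frequency (mu : borel_probability R X) :
  (forall nu : borel_probability R X, invariant_measure act nu ->
     forall A : set (g_sigma_algebraType (@open X)), measurable A ->
       nu A = mu A) ->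
  forall A, clopen A -> forall eps : R, 0 < eps ->
    exists s0 : nat, forall s, (s0 <= s)%N -> forall y,
      `|frequency R act (D s) y A - fine (mu A)| < eps.
Proof.
move=> uniq A cA eps eps0; apply: contrapT => nunif.
pose bad : set nat := [set s | exists y,
  eps <= `|frequency R act (D s) y A - fine (mu A)|].
(* [bad] is infinite, so it generates with the cofinite sets a proper filter *)
have Pbad : ProperFilter (within bad \oo).
  apply: Build_ProperFilter => -[N _ NP]; apply: nunif.
  exists N => s Ns y; rewrite ltNge; apply/negP => le_eps.
  by apply: (NP s Ns); exists y.
have [U [UU badU]] := ultraFilterLemma Pbad.
have PU : ProperFilter U by exact: ultra_proper.
have ooU : \oo `<=` U.
  by move=> P ooP; apply: badU; apply: filterS ooP.
have Ubad : U bad by apply: badU; apply: (@filterE _ \oo).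
have [y yP] : exists y : nat -> X, forall s, bad s ->
    eps <= `|frequency R act (D s) (y s) A - fine (mu A)|.
  have /choice[y yP] : forall s, exists z, bad s ->
      eps <= `|frequency R act (D s) z A - fine (mu A)|.
    move=> s; have [[z zP]|nbad] := pselect (bad s); first by exists z.
    by exists point.
  by exists y.
have [m inv_m lim_m] := frequency_limit y UU ooU.
have mA : @measurable _ (g_sigma_algebraType (@open X)) A.
  by apply: sub_sigma_algebra; exact: cA.1.
have /cvgrPdist_lt/(_ eps eps0) := lim_m A cA.
rewrite (uniq m inv_m A mA) => near_mu.
have [s [bads]] := filter_ex (filterI Ubad near_mu).
by rewrite distrC ltNge yP.
Qed.

End frequency_limit.

(** * Reading the position modulo a period in a finite window *)

Section phase.
Variables (G : zmodType) (S : finType) (x : config G S).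
Variables (Gamma D : nat -> set G).
Hypotheses (x_periods : period_structure x Gamma).
Hypotheses (D_fin : forall n, finite_set (D n)).
Hypotheses (D_fundamental : forall n, fundamental_domain (Gamma n) (D n)).

Lemma period_decreasing m n : (m <= n)%N -> Gamma n `<=` Gamma m.
Proof.
move=> mn; have [GS _ _ _] := x_periods; rewrite -(subnK mn).
elim: (n - m)%N => [//|k IH]; rewrite addSn.
exact: subset_trans (GS _) IH.
Qed.

Lemma period0 n : Gamma n 0.
Proof. by have [_ /(_ n)[[]]] := x_periods. Qed.

Lemma periodB n g h : Gamma n g -> Gamma n h -> Gamma n (g - h).
Proof. by have [_ /(_ n)[[_ H]] _ _ _] := x_periods; exact: H. Qed.

Lemma periodN n g : Gamma n g -> Gamma n (- g).
Proof. by move=> Gg; rewrite -sub0r; apply: periodB => //; exact: period0. Qed.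

Lemma periodD n g h : Gamma n g -> Gamma n h -> Gamma n (g + h).
Proof.
by move=> Gg Gh; rewrite -[h]opprK; apply: periodB => //; exact: periodN.
Qed.

(** A finite window that tells the coset of [h] apart from the period itself.  As
    [Gamma t] is an essential period, some [k] carries a constant symbol [a] on
    [k + Gamma t] while [x] takes another value at [k + h + c0] for some [c0] in
    [Gamma t].  The latter value is itself constant along a finer period
    [Gamma n], so that every shift of [x] by an element of [h + Gamma t] shows it
    somewhere in a window that represents [k + Gamma t] modulo [Gamma n]; such a
    window can be taken finite. *)
Lemma coset_window t h : ~ Gamma t h -> exists W : seq G,
  (forall w, w \in W -> forall c, Gamma t c -> x (w + c) = x w) /\
  (forall c, Gamma t c -> exists2 w, w \in W & x (w + (h + c)) <> x w).
Proof.
move=> nGh; have [_ _ /(_ t)[_ ess] perT] := x_periods.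
have [a [k [ka [c0 [Gc0 xc0]]]]] : exists a k, Per_at x (Gamma t) a k /\
    exists c0, Gamma t c0 /\ x (k + h + c0) <> a.
  apply: contrapT => noSep; apply: nGh; apply: ess => a k ka.
  exists (k + h); last by rewrite addrK.
  move=> c Gc; apply: contrapT => xc; apply: noSep.
  by exists a, k; split=> //; exists c.
(* [maxn] ensures that the finer period is contained in [Gamma t] *)
have [n [tn xn]] : exists n, (t <= n)%N /\
    forall c, Gamma n c -> x (k + h + c0 + c) = x (k + h + c0).
  have : (\bigcup_n Per x (Gamma n)) (k + h + c0) by rewrite -perT.
  move=> [n _ [b _ xb]]; exists (maxn n t); split; first exact: leq_maxr.
  move=> c /(period_decreasing (leq_maxl n t)) Gc.
  by rewrite -[in RHS](addr0 (k + h + c0)) !xb //; exact: period0.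
exists [seq k + r | r <- fset_set (D n `&` Gamma t)].
have mem_fs r : (r \in fset_set (D n `&` Gamma t)) = (r \in D n `&` Gamma t).
  by rewrite in_fset_set //; exact: finite_setIl.
split.
  move=> _ /mapP[r + ->] c Gc; rewrite mem_fs inE => -[_ Gr].
  by rewrite -addrA !ka //; exact: periodD.
move=> c Gc.
(* the representative of [c0 - c] modulo [Gamma n] moves the position
   [k + h + c0] of the exceptional symbol into the window shifted by [h + c] *)
have [r [[Dr [l Gl rE]] _]] := D_fundamental n (c0 - c).
rewrite -{}rE in Dr.
have Gr : Gamma t (c0 - c + l).
  by apply: periodD; [exact: periodB | exact: period_decreasing Gl].
exists (k + (c0 - c + l)).
  by apply/mapP; exists (c0 - c + l) => //; rewrite mem_fs inE.
rewrite ka //.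
rewrite (_ : _ + (h + c) = k + h + c0 + l) ?xn //.
rewrite -!addrA (addrCA h); congr (_ + (_ + _)).
by rewrite (addrA l) addrC addrK addrC.
Qed.

(** The union of the windows that exclude the finitely many cosets other than
    [Gamma t] itself. *)
Lemma phase_window t : exists W : seq G,
  forall g, Gamma t g <-> forall w, w \in W -> x (w + g) = x w.
Proof.
have /choice[W WP] : forall h, exists W : seq G,
    (forall w, w \in W -> forall c, Gamma t c -> x (w + c) = x w) /\
    (~ Gamma t h ->
      forall c, Gamma t c -> exists2 w, w \in W & x (w + (h + c)) <> x w).
  move=> h; have [Gh|/coset_window[W [W1 W2]]] := pselect (Gamma t h).
    by exists nil.
  by exists W.
exists (flatten [seq W h | h <- fset_set (D t)]) => g; split.
  by move=> Gg w /flatten_mapP[h _ wW]; exact: (WP h).1.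
move=> gW; apply: contrapT => nGg.
have [h [[Dh [c Gc gch]] _]] := D_fundamental t g.
have nGh : ~ Gamma t h.
  move=> Gh; apply: nGg; rewrite -[g](addrK c) gch; exact: periodB.
have [w wW] := (WP h).2 nGh (- c) (periodN Gc).
apply; rewrite -gch addrK; apply: gW.
by apply/flatten_mapP; exists h => //; rewrite in_fset_set ?inE.
Qed.

End phase.

(** * Block frequencies as frequencies of visits *)

Section tiling.
Variables (R : realType) (G : zmodType) (Gamma E D : set G).
Hypothesis Gamma_sub : subgroup Gamma.
Hypothesis D_fundamental : fundamental_domain Gamma D.
Hypotheses (E_fin : finite_set E) (D_fin : finite_set D).
Hypothesis E_tiling : E = \bigcup_(gamma in E `&` Gamma) translate gamma D.

Lemma card_tiling : cardR R E = cardR R D * cardR R (E `&` Gamma).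
Proof.
have E_image : E = (fun p => p.1 + p.2) @` ((E `&` Gamma) `*` D).
  rewrite {1}E_tiling; apply/seteqP; split.
    by move=> _ [c Ec [d Dd <-]]; exists (c, d).
  by move=> _ [[c d] [Ec Dd] <-]; exists c => //; exists d.
have fEG : finite_set (E `&` Gamma) by exact: finite_setIl.
rewrite {1}E_image mulrC -(cardRX R fEG D_fin).
apply: cardR_image; first exact: finite_setX.
move=> [c d] [c' d']; rewrite !inE => -[[_ Gc] Dd] [[_ Gc'] Dd'] /= eq_sum.
have [r [_ r_uniq]] := D_fundamental d.
have rd : r = d.
  by apply: r_uniq; split=> //; exists 0; rewrite ?addr0 //; case: Gamma_sub.
have rd' : r = d'.
  apply: r_uniq; split=> //; exists (c - c'); first by case: Gamma_sub => _; exact.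
  by apply: (addrI c'); rewrite -eq_sum addrCA (addrCA c') subrr addr0 addrC.
by move: eq_sum; rewrite -rd -rd' => /addIr ->.
Qed.

End tiling.

Section block_frequency.
Variables (R : realType) (G : countZmodType) (S : finType) (x : config G S).
Variables (Gamma D : nat -> set G) (t : nat) (B : D t -> S).
Hypothesis x_periods : period_structure x Gamma.
Hypothesis D_fin : forall n, finite_set (D n).
Hypothesis D_fundamental : forall n, fundamental_domain (Gamma n) (D n).
Hypothesis D_tiling : forall n l, (n < l)%N ->
  D l = \bigcup_(c in D l `&` Gamma n) translate c (D n).

(** The clopen set consists of the points that show [B] on [D t] and agree with
    [x] on a phase window of [Gamma t], and [y] is the shift of [x] by the
    element of [Gamma s] at which [C] is read; since that element also lies in
    [Gamma t], the window detects whether the position itself does. *)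
Lemma ap_frequency : blocks x (Gamma t) B ->
  exists2 A : set (subshift x), clopen A &
    forall s, (t < s)%N -> D s !=set0 ->
    forall C : D s -> S, blocks x (Gamma s) C ->
      exists y, ap R (Gamma t) B C =
        cardR R (D t) * frequency R (@subshift_act _ _ x) (D s) y A.
Proof.
move=> [b _ Bb]; have [W WP] := phase_window x_periods D_fin D_fundamental t.
pose p : seq (G * S) :=
  [seq (d, x (d + b)) | d <- fset_set (D t)] ++ [seq (w, x w) | w <- W].
exists (cylinder p); first exact: clopen_cylinder.
move=> s ts Ds0 C [c Gc Cc].
have tile g d : D s g -> Gamma t g -> D t d -> D s (d + g).
  move=> Dg Gg Dd; rewrite (D_tiling ts); exists g => //.
  by exists d; rewrite // addrC.
pose y : subshift x :=
  subshift_act c (SigSub (mem_set (@orbit_closure_refl _ _ x))).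
exists y.
have memA g : cylinder p (subshift_act g y) <->
    (forall d, D t d -> x (d + g + c) = x (d + b)) /\ Gamma t g.
  have memE e : set_val (subshift_act g y) e = x (e + g + c) by [].
  have Gtc : Gamma t c by exact: (period_decreasing x_periods (ltnW ts)).
  split.
    move=> pg; split.
      move=> d Dd; rewrite -memE; apply: (pg (d, _)); rewrite mem_cat map_f //.
      by rewrite in_fset_set ?inE.
    suff : Gamma t (g + c) by move=> /(periodB x_periods)/(_ Gtc); rewrite addrK.
    apply: (WP _).2 => w wW; rewrite addrA -memE; apply: (pg (w, _)).
    by rewrite mem_cat (map_f (fun w => (w, x w)) wW) orbT.
  move=> [gB Gg] e; rewrite mem_cat => /orP[] /mapP[d dX ->]; rewrite memE /=.
    by apply: gB; move: dX; rewrite in_fset_set ?inE.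
  by rewrite -addrA; apply: (WP (g + c)).1 => //; exact: (periodD x_periods).
rewrite /ap /frequency.
have -> : visits (@subshift_act _ _ x) (D s) y (cylinder p) =
    [set g | (D s `&` Gamma t) g /\ forall d : D t,
       exists2 e : D s, set_val e = set_val d + g & C e = B d].
  apply/seteqP; split=> g /=.
    move=> [Dg /memA[gB Gg]]; split=> // d.
    have De : D s (set_val d + g) by apply: tile => //; exact: set_valP.
    exists (SigSub (mem_set De)) => //.
    by rewrite Cc Bb /=; apply: gB; exact: set_valP.
  move=> [[Dg Gg] gB]; split=> //; apply/memA; split=> // d Dd.
  have [e eE] := gB (SigSub (mem_set Dd)).
  by rewrite Cc Bb eE.
have Gt_sub : subgroup (Gamma t) by have [_ /(_ t)[]] := x_periods.
have card_Ds := card_tiling R Gt_sub (D_fundamental t) (D_fin s) (D_fin t)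
  (D_tiling ts).
have Dt0 : cardR R (D t) != 0.
  have := cardR_gt0 R (D_fin s) Ds0.
  by rewrite card_Ds; apply: contraTneq => ->; rewrite mul0r ltxx.
by rewrite card_Ds invfM [RHS]mulrCA mulVKf // mulrC.
Qed.

End block_frequency.

(** The limit is the cardinality of [D t] times the measure of the clopen set of
    [ap_frequency]; countability of the group is what makes the subshift second
    countable. *)
Theorem uniform_block_frequency (R : realType) (G : countZmodType) (S : finType)
    (x : config G S) (Gamma D : nat -> set G)
    (x_periods : period_structure x Gamma)
    (D0 : forall n, D n 0)
    (D_fundamental : forall n, fundamental_domain (Gamma n) (D n))
    (D_tiling : forall n l, (n < l)%N ->
       D l = \bigcup_(gamma in D l `&` Gamma n) translate gamma (D n))
    (D_folner : folner R D)
    (x_strictly_ergodic : strictly_ergodic R (@subshift_act _ _ x))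
    (t : nat) (B : D t -> S) (B_block : blocks x (Gamma t) B) :
  exists nu : R, forall eps : R, 0 < eps ->
    exists s0 : nat, forall s : nat, (s0 <= s)%N ->
      forall C : D s -> S, blocks x (Gamma s) C ->
        `|ap R (Gamma t) B C - nu| < eps.
Proof.
have D_neq0 n : D n !=set0 by exists 0.
have D_fin := D_folner.1.
have [A cA apE] := ap_frequency R x_periods D_fin D_fundamental D_tiling B_block.
have [_ [mu [_ mu_unique]]] := x_strictly_ergodic.
have cardDt : 0 < cardR R (D t) by exact: cardR_gt0.
exists (cardR R (D t) * fine (mu A)) => eps eps0.
have [s0 s0P] := uniform_frequency (@subshift_actD _ _ x)
  (@subshift_act_continuous _ _ x) (@compact_subshift _ _ x)
  (@clopen_sigma_base_subshift _ _ x) D_neq0 D_folner mu_unique cA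
  (divr_gt0 eps0 cardDt).
exists (maxn s0 t.+1) => s; rewrite geq_max => /andP[s0s ts] C C_block.
have [y ->] := apE s ts (D_neq0 s) C C_block.
rewrite -mulrBr normrM gtr0_norm // mulrC -ltr_pdivlMr //.
exact: s0P.
Qed.

Theorem theorem3p20 (R : realType) (d : nat) (S : finType)
    (x : config 'rV[int]_d S) (Gamma D : nat -> set 'rV[int]_d)
    (x_toeplitz : toeplitz x)
    (x_periods : period_structure x Gamma)
    (Gamma_cap : \bigcap_n Gamma n = [set 0])
    (D_cover : [set: 'rV[int]_d] = \bigcup_m D m)
    (D_nondecreasing : forall n, D n 0 /\ D n `<=` D n.+1)
    (D_fundamental : forall n, fundamental_domain (Gamma n) (D n))
    (D_tiling : forall n l, (n < l)%N ->
       D l = \bigcup_(gamma in D l `&` Gamma n) translate gamma (D n))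
    (D_folner : folner R D)
    (x_strictly_ergodic : strictly_ergodic R (@subshift_act _ _ x))
    (t : nat) (B : D t -> S) (B_block : blocks x (Gamma t) B) :
  exists nu : R, forall eps : R, 0 < eps ->
    exists s0 : nat, forall s : nat, (t <= s)%N -> (s0 <= s)%N ->
      forall C : D s -> S, blocks x (Gamma s) C ->
        `|ap R (Gamma t) B C - nu| < eps.
Proof.
have [nu nuP] := @uniform_block_frequency R 'rV[int]_d S x Gamma D x_periods
  (fun n => (D_nondecreasing n).1) D_fundamental D_tiling D_folner
  x_strictly_ergodic t B B_block.
exists nu => eps /nuP[s0 s0P].
by exists s0 => s _; exact: s0P.
Qed.
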